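(* Let $K/k$ be a separable field extension of degree $6$ and let $\widetilde{K}/k$ be its Galois closure. If $\operatorname{Gal}(\widetilde{K}/k)=2A_4$, there exist two fields $F$ with $K\subseteq F\subseteq\widetilde{K}$ such that $[F:k]=12$ and $F/k$ is almost classically Galois.
   Context: $2A_4$ denotes the transitive permutation group $6T6$ of degree $6$ and order $24$; abstractly it is isomorphic to $A_4\times C_2$. The Galois group $G=\operatorname{Gal}(\widetilde{K}/k)$ is viewed as a transitive permutation group of degree $6$ via left translation on $G/\operatorname{Gal}(\widetilde{K}/K)$. Let $L/k$ be a finite separable extension with Galois closure $\widetilde{L}/k$, $\Gamma=\operatorname{Gal}(\widetilde{L}/k)$, $\Gamma'=\operatorname{Gal}(\widetilde{L}/L)$, and let $\lambda:\Gamma\to\operatorname{Sym}(\Gamma/\Gamma')$ be the left translation action on left cosets. $L/k$ is called almost classically Galois if there is a regular (i.e. sharply transitive) subgroup $N$ of $\operatorname{Sym}(\Gamma/\Gamma')$ which is normalized by $\lambda(\Gamma)$ and contained in $\lambda(\Gamma)$; equivalently, $\Gamma'$ has a normal complement in $\Gamma$. *)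

(* Defs.v *)
From mathcomp Require Export all_boot all_order all_algebra all_fingroup.
From mathcomp Require Export all_solvable all_field.

Set Implicit Arguments.
Unset Strict Implicit.
Unset Printing Implicit Defensive.

Import GRing.Theory GroupScope.

Definition regular_perm_group (X : finType) (N : {set {perm X}}) : Prop :=
  forall x y : X, exists! s : {perm X}, s \in N /\ s x = y.

Definition perm_isomorphic (X Y : finType)
    (G : {set {perm X}}) (H : {set {perm Y}}) : Prop :=
  exists2 f : X -> Y, bijective f &
    forall (s : {perm X}) (t : {perm Y}),
      (forall x : X, f (s x) = t (f x)) -> (s \in G) = (t \in H).

(* 6T6 = <(3 6), (1 3 5)(2 4 6)>, with the points 1, ..., 6 taken mod 6; the
   second generator is translation by 2. *)
Definition group_2A4 : {group {perm 'Z_6}} :=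
  <<[set tperm (3%R : 'Z_6) (6%R : 'Z_6); perm (@addrI 'Z_6 2%R)]>>%G.

Definition is_galois_closure (k : fieldType) (L : splittingFieldType k)
    (E M : {subfield L}) : Prop :=
  [/\ (E <= M)%VS, galois 1%VS M &
      forall M' : {subfield L}, (E <= M')%VS -> galois 1%VS M' -> (M <= M')%VS].

(* In 'Gal(M / 1) the product x * y applies x first.  Hence the left coset
   {g \o h | h in 'Gal(M / E)} is the right coset 'Gal(M / E) :* g, and left
   translation by a, g |-> a \o g, is right multiplication by a. *)
Definition gal_cosets (k : fieldType) (L : splittingFieldType k)
    (E M : {subfield L}) : finType :=
  {C : {set gal_of M} | C \in rcosets 'Gal(M / E) 'Gal(M / 1%VS)}.

Definition gal_translations (k : fieldType) (L : splittingFieldType k)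
    (E M : {subfield L}) : {set {perm gal_cosets E M}} :=
  actperm ('Rs^?)%act @* 'Gal(M / 1%VS).

(* The domain of the restricted action is all of 'Gal(M / 1), so no element
   is lost by taking the morphic image above. *)
Lemma gal_translationsE (k : fieldType) (L : splittingFieldType k)
    (E M : {subfield L}) (s : {perm gal_cosets E M}) :
  reflect (exists2 x, x \in 'Gal(M / 1%VS) &
             forall C : gal_cosets E M, val (s C) = val C :* x)
          (s \in gal_translations E M).
Proof.
have dom (x : gal_of M) : x \in 'Gal(M / 1%VS) ->
    x \in subact_dom [pred C | C \in rcosets 'Gal(M / E) 'Gal(M / 1%VS)] 'Rs.
  move=> Gx; have sN := actsRs_rcosets 'Gal(M / E) 'Gal(M / 1%VS).
  have := subsetP sN x Gx; rewrite !inE /= => /subsetP NC.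
  by apply/subsetP=> C; rewrite !inE => /NC; rewrite inE.
have valE (x : gal_of M) (C : gal_cosets E M) : x \in 'Gal(M / 1%VS) ->
    val (actperm ('Rs^?)%act x C) = val C :* x.
  by move=> Gx; rewrite actpermE val_subact dom //= rcosetE.
apply: (iffP idP) => [/morphimP[x _ Gx ->] | [x Gx sE]].
  by exists x => // C; apply: valE.
apply/morphimP; exists x => //; first exact: dom.
by apply/permP=> C; apply: val_inj; rewrite sE valE.
Qed.

Definition almost_classically_galois (k : fieldType) (L : splittingFieldType k)
    (E : {subfield L}) : Prop :=
  exists2 M : {subfield L}, is_galois_closure E M &
    exists N : {group {perm gal_cosets E M}},
      [/\ regular_perm_group N,
          gal_translations E M \subset 'N(N) &
          N \subset gal_translations E M].

(* Main.v *)
Require Import Defs.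

Set Implicit Arguments.
Unset Strict Implicit.
Unset Printing Implicit Defensive.

Import GRing.Theory GroupScope.

(* Let E/k have Galois closure M/k.  Then E/k is almost classically Galois iff
   Gal(M/E) has a normal complement in Gal(M/k).  In 2A_4 the stabiliser of p is
   the Klein group {1, a, b, ab}, where a = (p+1 p+4) and b = (p+2 p+5) are
   transpositions; hence the intermediate fields of degree 12 correspond to
   <a>, <b> and <ab>, and all of them have Galois closure Kt.  The even
   permutations form the only subgroup of index 2 of 2A_4, hence the only
   candidate for a normal complement to a subgroup of order 2: they complement
   <a> and <b>, but contain ab. *)

(** * Subgroups of index 2 *)

Lemma sqr_index2 (gT : finGroupType) (G N : {group gT}) (x : gT) :
  N \subset G -> #|G : N| = 2 -> x \in G -> x ^+ 2 \in N.
Proof.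
move=> sNG iN Gx; have nNG := normal_norm (index2_normal sNG iN).
have Nx := subsetP nNG x Gx.
rewrite coset_idr ?groupX // morphX //; apply/eqP; rewrite -order_dvdn -iN.
by rewrite -card_quotient // order_dvdG ?mem_quotient.
Qed.

(** Subgroups of index 2 contain all squares, hence [c], which equals [c ^+ 4]. So [G] modulo
    [N :&: M] is generated by the image of [t], whose square is trivial; the intersection then has
    index at most 2 and fills both [N] and [M]. *)
Lemma index2_gen2_uniq (gT : finGroupType) (t c : gT) (G N M : {group gT}) :
    G :=: <<[set t; c]>> -> c ^+ 3 = 1 ->
    N \subset G -> #|G : N| = 2 -> M \subset G -> #|G : M| = 2 ->
  N :=: M.
Proof.
move=> defG c3 sNG iN sMG iM.
have [Gt Gc] : t \in G /\ c \in G.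
  by rewrite defG; split; apply: mem_gen; rewrite !inE eqxx ?orbT.
have nsKG : N :&: M <| G.
  have /andP[_ nMG] := index2_normal sMG iM.
  have /andP[_ nNG] := index2_normal sNG iN.
  by rewrite /normal subIset ?sNG ?normsI.
have sqK x : x \in G -> x ^+ 2 \in N :&: M.
  by move=> Gx; rewrite inE !(@sqr_index2 _ G).
have Kc : c \in N :&: M.
  by rewrite -[c]mulg1 -c3 -expgS (expgM c 2 2) groupX ?sqK.
have nKG := normal_norm nsKG; have nKt := subsetP nKG t Gt.
have defGt : <[t]> * (N :&: M) = G.
  apply/eqP; rewrite eqEsubset mul_subG ?cycle_subG ?(normal_sub nsKG) //=.
  rewrite -norm_joinEl ?cycle_subG // {1}defG gen_subG; apply/subsetP=> x.
  rewrite !inE => /pred2P[] ->; first by rewrite mem_gen // inE cycle_id.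
  by rewrite mem_gen // inE Kc orbT.
have le2 : #|G : N :&: M| <= 2.
  rewrite -card_quotient // -defGt quotientMidr quotient_cycle //.
  rewrite dvdn_leq // order_dvdn -morphX //.
  by apply/eqP/coset_id/sqK.
have eqK (A : {group gT}) : N :&: M \subset A -> A \subset G -> #|G : A| = 2 ->
    N :&: M = A.
  move=> sKA sAG iA; apply/eqP; rewrite eqEcard sKA /=.
  rewrite -(leq_pmul2r (isT : 0 < 2)) -{1}iA Lagrange //.
  by rewrite -(Lagrange (normal_sub nsKG)) leq_mul2l le2 orbT.
by rewrite -(eqK N) ?subsetIl // {1}(eqK M) ?subsetIr.
Qed.

(** * The permutation group 2A_4: transpositions, blocks, stabilisers, even part *)

Definition pairflip (i : 'Z_6) : {perm 'Z_6} := tperm i (i + 3%R)%R.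

(** As 6 is 0 in ['Z_6], the first generator is both [pairflip 3] and [pairflip 0]; conjugation by
    translation by 2 yields the remaining indices. *)
Lemma pairflip_2A4 (i : 'Z_6) : pairflip i \in group_2A4.
Proof.
have flipS j : pairflip j \in group_2A4 -> pairflip (2%R + j)%R \in group_2A4.
  move=> Pj; have -> : pairflip (2%R + j)%R = pairflip j ^ perm (@addrI 'Z_6 2%R).
    by rewrite /pairflip tpermJ !permE (addrA _ j).
  by rewrite groupJ // mem_gen // !inE eqxx orbT.
have Pt : tperm (3%R : 'Z_6) (6%R : 'Z_6) \in group_2A4.
  by rewrite mem_gen // !inE eqxx.
have P3 : pairflip 3%R \in group_2A4.
  by rewrite /pairflip; have -> : (3%R + 3%R)%R = 6%R :> 'Z_6 by apply: val_inj.
have P0 : pairflip 0%R \in group_2A4.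
  rewrite /pairflip add0r tpermC.
  by have -> : 0%R = 6%R :> 'Z_6 by apply: val_inj.
have step := (flipS _ P0, flipS _ P3).
have step2 := (flipS _ step.1, flipS _ step.2).
case: i => [[|[|[|[|[|[|//]]]]]] lti].
- by rewrite (_ : Ordinal lti = 0%R) //; apply: val_inj.
- by rewrite (_ : Ordinal lti = (2%R + (2%R + 3%R))%R) ?step2 //; apply: val_inj.
- by rewrite (_ : Ordinal lti = (2%R + 0%R)%R) ?step //; apply: val_inj.
- by rewrite (_ : Ordinal lti = 3%R) //; apply: val_inj.
- by rewrite (_ : Ordinal lti = (2%R + (2%R + 0%R))%R) ?step2 //; apply: val_inj.
by rewrite (_ : Ordinal lti = (2%R + 3%R)%R) ?step //; apply: val_inj.
Qed.

(* Doubling kills exactly 0 and 3, so the second clause says that s induces a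
   translation on the three blocks {i, i + 3}. *)
Lemma blocks_2A4 (s : {perm 'Z_6}) : s \in group_2A4 ->
  (forall x, s (x + 3%R) = s x + 3%R)%R /\
  (forall x y, (s x - x) *+ 2 = (s y - y) *+ 2)%R.
Proof.
(* Both clauses survive composition, so they cut out a group, and only the two generators need
   checking. *)
pose I := [set s : {perm 'Z_6} |
  [forall x, s (x + 3%R) == s x + 3%R]%R &&
  [forall x, forall y, (s x - x) *+ 2 == (s y - y) *+ 2]%R].
have gI : group_set I.
  apply/group_setP; split=> [|u v].
    rewrite inE; apply/andP; split; first by apply/forallP=> x; rewrite !perm1.
    by apply/forallP=> x; apply/forallP=> y; rewrite !perm1 !subrr.
  rewrite !inE => /andP[/forallP u3 /forallP u2] /andP[/forallP v3 /forallP v2].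
  apply/andP; split.
    by apply/forallP=> x; rewrite !permM (eqP (u3 x)) (eqP (v3 _)).
  apply/forallP=> x; apply/forallP=> y; rewrite !permM.
  (* The displacement of [u * v] at [x] is that of [v] at [u x] plus that of [u] at [x]. *)
  rewrite -(subrKA (u x) _ (- x)%R) -(subrKA (u y) _ (- y)%R).
  rewrite (mulrnDl 2 (v (u x) - u x)%R) (mulrnDl 2 (v (u y) - u y)%R).
  by rewrite (eqP (forallP (u2 x) y)) (eqP (forallP (v2 (u x)) (u y))).
have sPI : group_2A4 \subset Group gI.
  rewrite gen_subG; apply/subsetP=> u; rewrite !inE => /pred2P[] ->; apply/andP; split.
  - apply/forallP=> x; rewrite !permE /=.
    by case: x => [[|[|[|[|[|[|//]]]]]] ltx].
  - apply/forallP=> x; apply/forallP=> y; rewrite !permE /=.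
    by case: x y => [[|[|[|[|[|[|//]]]]]] ltx] [[|[|[|[|[|[|//]]]]]] lty].
  - by apply/forallP=> x; rewrite !permE (addrA _ x).
  by apply/forallP=> x; apply/forallP=> y; rewrite !permE !addrK.
move/(subsetP sPI); rewrite inE => /andP[/forallP s3 /forallP s2].
by split=> [x | x y]; apply/eqP; [apply: s3 | apply: (forallP (s2 x))].
Qed.

Lemma odd_pairflip (i : 'Z_6) : odd_perm (pairflip i).
Proof. by rewrite odd_tperm; case: i => [[|[|[|[|[|[|//]]]]]] lti]. Qed.

(** An element fixing [p] preserves the block of [p], hence every block. It is then determined by
    whether it flips the blocks of [p + 1] and [p + 2], which leaves four possibilities. *)
Lemma stab_2A4 (p : 'Z_6) (a := pairflip (p + 1%R)%R)
  (b := pairflip (p + 2%R)%R) (s : {perm 'Z_6}) :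
  (s \in group_2A4) && (s p == p) = (s \in [set 1; a; b; a * b]).
Proof.
have [sP ap bp] : [/\ [set 1; a; b; a * b] \subset group_2A4, a p = p & b p = p].
  split.
  - apply/subsetP=> x; rewrite !inE -!orbA.
    by case/or4P=> /eqP-> //; rewrite ?groupM ?pairflip_2A4 ?group1.
  - by rewrite permE /=; case: p @a @b => [[|[|[|[|[|[|//]]]]]] ltp].
  by rewrite permE /=; case: p @a @b => [[|[|[|[|[|[|//]]]]]] ltp].
apply/andP/idP=> [[Ps /eqP sp] | Ss]; last first.
  split; first exact: (subsetP sP).
  by move: Ss; rewrite !inE -!orbA => /or4P[] /eqP->;
     rewrite ?permM ?perm1 ?ap ?bp ?ap ?bp.
have [s3 s2] := blocks_2A4 Ps.
have flip x : s x = x \/ s x = (x + 3%R)%R.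
  have := s2 x p; rewrite sp subrr mul0rn => sx2.
  have: (s x - x)%R \in [:: 0%R; 3%R].
    by case: (s x - x)%R sx2 => [[|[|[|[|[|[|//]]]]]] ltx].
  rewrite !inE => /pred2P[/eqP|/eqP]; first by rewrite subr_eq0 => /eqP; left.
  by rewrite subr_eq addrC => /eqP; right.
(* The points [p], [p + 1], [p + 2] meet each block once, and elements of the group commute with
   adding 3, so the images of these points determine an element. *)
have ext u : u \in group_2A4 -> u p = p -> u (p + 1%R)%R = s (p + 1%R)%R ->
    u (p + 2%R)%R = s (p + 2%R)%R -> s = u.
  move=> Pu up u1 u2; have [u3 _] := blocks_2A4 Pu.
  apply/permP=> x; rewrite -(subrK p x) addrC.
  case: (x - p)%R => [[|[|[|[|[|[|//]]]]]] ltx].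
  - by rewrite (_ : Ordinal ltx = 0%R) ?addr0 ?sp ?up //; apply: val_inj.
  - by rewrite (_ : Ordinal ltx = 1%R) ?u1 //; apply: val_inj.
  - by rewrite (_ : Ordinal ltx = 2%R) ?u2 //; apply: val_inj.
  - rewrite (_ : Ordinal ltx = 3%R); last exact: val_inj.
    by rewrite s3 u3 sp up.
  - rewrite (_ : Ordinal ltx = (1%R + 3%R)%R); last exact: val_inj.
    by rewrite addrA s3 u3 u1.
  rewrite (_ : Ordinal ltx = (2%R + 3%R)%R); last exact: val_inj.
  by rewrite addrA s3 u3 u2.
have a1 : a (p + 1%R)%R = (p + 1%R + 3%R)%R by rewrite tpermL.
have b2 : b (p + 2%R)%R = (p + 2%R + 3%R)%R by rewrite tpermL.
have b1 : b (p + 1%R)%R = (p + 1%R)%R.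
  by rewrite permE /=; case: (p) => [[|[|[|[|[|[|//]]]]]] ltp].
have b4 : b (p + 1%R + 3%R)%R = (p + 1%R + 3%R)%R.
  by rewrite permE /=; case: (p) => [[|[|[|[|[|[|//]]]]]] ltp].
have a2 : a (p + 2%R)%R = (p + 2%R)%R.
  by rewrite permE /=; case: (p) => [[|[|[|[|[|[|//]]]]]] ltp].
have [Pa Pb] : a \in group_2A4 /\ b \in group_2A4 by rewrite !pairflip_2A4.
rewrite !inE -!orbA.
case: (flip (p + 1%R)%R) (flip (p + 2%R)%R) => e1 [] e2.
- by rewrite (ext 1) ?eqxx ?perm1 ?e1 ?e2.
- by rewrite (ext b) ?eqxx ?orbT ?b1 ?b2 ?e1 ?e2.
- by rewrite (ext a) ?eqxx ?orbT ?a1 ?a2 ?e1 ?e2.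
by rewrite (ext (a * b)) ?groupM ?eqxx ?orbT // permM ?ap ?a1 ?a2 ?b4 ?b2 ?e1 ?e2.
Qed.

Definition even_2A4 : {group {perm 'Z_6}} := (group_2A4 :&: 'Alt_('Z_6))%G.

Lemma index_even_2A4 : #|group_2A4 : even_2A4| = 2.
Proof.
(* The alternating group is the kernel of the sign, so the index is the size of the image of
   [group_2A4] in [bool]. *)
rewrite indexgI /= /Alt -(setTI group_2A4) -card_morphim /=.
rewrite -[RHS]card_bool -cardsT; congr #|pred_of_set _|.
apply/eqP; rewrite eqEsubset subsetT /=; apply/subsetP=> b _.
case: b; apply/morphimP.
  exists (pairflip 0%R); rewrite ?inE ?pairflip_2A4 //.
  exact/esym/odd_pairflip.
by exists 1; rewrite ?group1 //= odd_perm1.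
Qed.

Lemma index2_2A4 (N : {group {perm 'Z_6}}) :
  N \subset group_2A4 -> #|group_2A4 : N| = 2 -> N :=: even_2A4.
Proof.
move=> sN iN; apply: (index2_gen2_uniq (erefl (gval group_2A4)) _ sN iN).
(* The generator of order 3: the cube of translation by 2 is translation by 6, that is by 0. *)
- apply/permP=> x; rewrite perm1 !expgS expg0 mulg1 !permM !permE !addrA.
  by rewrite -[RHS]add0r; congr (_ + _)%R; apply: val_inj.
- exact: subsetIl.
exact: index_even_2A4.
Qed.

(** * Translations of cosets and normal complements in the Galois group *)

Section Translations.

Variables (k : fieldType) (L : splittingFieldType k) (E M : {subfield L}).

Lemma gal_cosets_dom :
  'Gal(M / 1%VS) \subset
    subact_dom [pred C | C \in rcosets 'Gal(M / E) 'Gal(M / 1%VS)] 'Rs.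
Proof.
apply/subsetP=> x Gx.
have := subsetP (actsRs_rcosets 'Gal(M / E) 'Gal(M / 1%VS)) x Gx.
rewrite !inE /= => /subsetP NC.
by apply/subsetP=> C; rewrite !inE => /NC; rewrite inE.
Qed.

(** Restricting the domain makes kernels and preimages subgroups of the Galois group itself. *)
Definition gal_translation :
    {morphism 'Gal(M / 1%VS) >-> {perm gal_cosets E M}} :=
  restrm_morphism gal_cosets_dom (actperm ('Rs^?)%act).

Lemma gal_translation_val x C : x \in 'Gal(M / 1%VS) ->
  val (gal_translation x C) = val C :* x.
Proof.
move=> Gx; rewrite /= /restrm actpermE val_subact.
by rewrite (subsetP gal_cosets_dom) //= rcosetE.
Qed.

Lemma gal_translation_im :
  gal_translation @* 'Gal(M / 1%VS) = gal_translations E M.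
Proof. by rewrite morphim_restrm setIid. Qed.

Lemma gal_sub1 : 'Gal(M / E) \subset 'Gal(M / 1%VS).
Proof. exact/galS/sub1v. Qed.

Lemma base_coset_subproof :
  'Gal(M / E) \in rcosets 'Gal(M / E) 'Gal(M / 1%VS).
Proof. by apply/rcosetsP; exists 1; rewrite ?group1 // mulg1. Qed.

Definition base_coset : gal_cosets E M :=
  exist (fun C : {set gal_of M} => C \in rcosets 'Gal(M / E) 'Gal(M / 1%VS))
    _ base_coset_subproof.

Lemma gal_translation_base x : x \in 'Gal(M / 1%VS) ->
  (gal_translation x base_coset == base_coset) = (x \in 'Gal(M / E)).
Proof.
move=> Gx; rewrite -val_eqE gal_translation_val //=.
by apply/eqP/idP=> [<- | /rcoset_id]; first exact: rcoset_refl.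
Qed.

Lemma gal_cosetP (C : gal_cosets E M) :
  exists2 g, g \in 'Gal(M / 1%VS) & C = gal_translation g base_coset.
Proof.
have /rcosetsP[g Gg defC] := valP C; exists g => //.
by apply: val_inj; rewrite gal_translation_val.
Qed.

Hypothesis clM : is_galois_closure E M.

Lemma gal_closure_dim : \dim E = #|'Gal(M / 1%VS) : 'Gal(M / E)|.
Proof.
have [sEM galM _] := clM.
rewrite -(dim_fixed_galois galM gal_sub1) dimv1 divn1.
have galEM : galois E M by apply: galoisS galM; rewrite sub1v.
by rewrite (galois_fixedField galEM).
Qed.

(* The fixed field of the kernel is a Galois extension containing E. *)
Lemma gal_translation_inj : 'injm gal_translation.
Proof.
have [sEM galM minM] := clM.
have sKE : 'ker gal_translation \subset 'Gal(M / E).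
  apply/subsetP=> x /[dup]/dom_ker Gx /mker x1.
  by rewrite -gal_translation_base // x1 perm1.
have le := minM (fixedField_aspace ('ker gal_translation)).
have /(galS M) : (M <= fixedField ('ker gal_translation))%VS.
  apply: le; last exact: normal_fixedField_galois (ker_normal _).
  by rewrite -galois_connection.
rewrite gal_fixedField => /subset_trans-> //; apply/subsetP=> x Mx.
by apply/set1gP/eqP/gal_eqP=> a Ma; rewrite gal_id (fixed_gal _ Mx).
Qed.

(** [N] and [D] correspond under [gal_translation]: transitivity on cosets amounts to
    ['Gal(M / E) * D] being everything, and freeness at the base coset to trivial intersection. *)
Lemma almost_classically_galoisP :
  almost_classically_galois E <->
  exists2 D : {group gal_of M}, D <| 'Gal(M / 1%VS) &
    D \in [complements to 'Gal(M / E) in 'Gal(M / 1%VS)].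
Proof.
split=> [[M' clM' [N]] | [D /andP[sDG nDG] /complP[tiQD defG]]].
  (* By minimality, two Galois closures contain each other. *)
  have eqM : M' = M.
    have [sEM galM minM] := clM; have [sEM' galM' minM'] := clM'.
    by apply/val_inj/eqP; rewrite eqEsubv minM' // minM.
  subst M'; rewrite -gal_translation_im => -[regN nN sN].
  have nsD : (gal_translation @*^-1 N)%G <| 'Gal(M / 1%VS).
    rewrite /normal subsetIl /=; apply: subset_trans (morphpre_norm _ _).
    by rewrite -sub_morphim_pre.
  exists (gal_translation @*^-1 N)%G => //; apply/complP; split.
    apply/trivgP/subsetP=> x /setIP[Qx /morphpreP[Gx Nx]].
    (* The identity and the translation by [x] both lie in [N] and fix the base coset, so regularity
       identifies them. *)
    have [s [_ uniq_s]] := regN base_coset base_coset.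
    have s1 : s = 1 by apply: uniq_s; rewrite group1 perm1.
    have sx : s = gal_translation x.
      by apply: uniq_s; split=> //; apply/eqP; rewrite gal_translation_base.
    by rewrite (subsetP gal_translation_inj) //; apply/kerP; rewrite // -sx.
  apply/eqP; rewrite eqEsubset mul_subG ?gal_sub1 ?subsetIl //=.
  apply/subsetP=> g Gg.
  have [s [[Ns sE] _]] := regN base_coset (gal_translation g base_coset).
  have /morphimP[d Gd _ defs] := subsetP sN s Ns.
  apply/mulsgP; exists (g * d^-1) d; last by rewrite mulgKV.
    rewrite -gal_translation_base ?groupM ?groupV // morphM ?groupV // permM.
    by rewrite -sE defs morphV // permK.
  by rewrite !inE Gd -defs.
exists M => //; exists (gal_translation @* D)%G.
rewrite -gal_translation_im.
(* Conjugating by [g^-1] moves the fixed coset to the base coset and stays in [D] by normality. *)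
have freeD g w : g \in 'Gal(M / 1%VS) -> w \in D ->
    gal_translation w (gal_translation g base_coset)
      = gal_translation g base_coset -> w = 1.
  move=> Gg Dw fix_w; have Gw := subsetP sDG w Dw.
  have: w ^ g^-1 \in 'Gal(M / E) :&: D.
    apply/setIP; split; last by rewrite memJ_norm ?groupV ?(subsetP nDG).
    rewrite -gal_translation_base ?groupJ ?groupV // conjgE invgK.
    rewrite !morphM ?groupM ?groupV // !permM fix_w.
    by rewrite morphV // permK.
  by rewrite tiQD => /set1gP/eqP; rewrite conjg_eq1 => /eqP.
split; [|exact: morphim_norms|exact: morphimS].
move=> C1 C2; have [g1 Gg1 ->] := gal_cosetP C1.
have [g2 Gg2 ->] := gal_cosetP C2.
(* From [g2 = q * d * g1] and [d * g1 = g1 * d ^ g1], the element [d ^ g1] of [D] carries the coset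
   of [g1] to that of [g2]. *)
have /mulsgP[q d Qq Dd defq] : g2 * g1^-1 \in 'Gal(M / E) * D.
  by rewrite defG groupM ?groupV.
have Gq := subsetP gal_sub1 q Qq; have Gd := subsetP sDG d Dd.
have Ddg : d ^ g1 \in D by rewrite memJ_norm ?(subsetP nDG).
have Gdg := subsetP sDG _ Ddg.
have dgE : gal_translation (d ^ g1) (gal_translation g1 base_coset)
         = gal_translation g2 base_coset.
  have /eqP qE : gal_translation q base_coset == base_coset.
    by rewrite gal_translation_base.
  rewrite -[in LHS]qE -!permM -!morphM ?groupM ?groupV //.
  congr (fun_of_perm (gal_translation _) _).
  by rewrite conjgE mulKVg mulgA -defq mulgKV.
exists (gal_translation (d ^ g1)); split; first by rewrite mem_morphim.
move=> s [/morphimP[e Ge De ->]]; rewrite -dgE => eE.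
congr (gal_translation _); apply/eqP; rewrite eq_mulgV1; apply/eqP.
apply: (freeD g1 _ Gg1); first by apply: groupM; rewrite ?groupV.
by rewrite morphM ?groupV // permM morphV // -eE permK.
Qed.

End Translations.

(** * Subgroups of order 2 in a point stabiliser *)

Lemma order_pairflip (i : 'Z_6) : #[pairflip i] = 2.
Proof.
apply: nt_prime_order => //; first by rewrite expgS expg1 tperm2.
by apply/eqP=> t1; have := odd_pairflip i; rewrite t1 odd_perm1.
Qed.

Lemma pairflip_neq (p : 'Z_6) : pairflip (p + 1%R)%R != pairflip (p + 2%R)%R.
Proof.
apply/eqP=> /permP/(_ (p + 1%R)%R); rewrite tpermL permE /=.
by case: p => [[|[|[|[|[|[|//]]]]]] ltp].
Qed.

Lemma order2_stab_2A4 (p : 'Z_6) (a := pairflip (p + 1%R)%R)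
  (b := pairflip (p + 2%R)%R) (R : {group {perm 'Z_6}}) :
    R \subset [set 1; a; b; a * b] -> #|R| = 2 ->
  R :&: even_2A4 = 1 <-> R :=: <[a]> \/ R :=: <[b]>.
Proof.
move=> sRS cR.
have noteven i : pairflip i \notin even_2A4.
  by rewrite inE Alt_even odd_pairflip andbF.
split=> [ti | defR].
  have [x Rx nx1] : exists2 x, x \in R & x != 1.
    by apply/trivgPn; rewrite -cardG_gt1 cR.
  have defRx i : x = pairflip i -> R :=: <[pairflip i]>.
    move=> xE; apply/esym/eqP; rewrite eqEcard cycle_subG -xE Rx /=.
    by rewrite xE -orderE order_pairflip cR.
  have := subsetP sRS x Rx; rewrite !inE -!orbA (negPf nx1) /=.
  case/or3P=> /eqP xE; [left | right |]; try exact: defRx.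
  (* The remaining case [x = a * b] is even, so [x] lies in the trivial intersection. *)
  case/negP: nx1; apply/eqP/set1gP; rewrite -ti inE Rx xE.
  by rewrite inE groupM ?pairflip_2A4 // Alt_even odd_permM !odd_pairflip.
apply: prime_TIg; first by rewrite cR.
by case: defR => ->; rewrite cycle_subG noteven.
Qed.

Lemma card_stab_2A4 (p : 'Z_6) (a := pairflip (p + 1%R)%R)
  (b := pairflip (p + 2%R)%R) : #|[set 1; a; b; a * b]| = 4.
Proof.
have neq_odd (s t : {perm 'Z_6}) : odd_perm s != odd_perm t -> s != t.
  by apply: contraNneq => ->.
have ab : a != b := pairflip_neq p.
have ab1 : 1 != a * b.
  by apply: contraNneq ab => /esym/eqP; rewrite -eq_invg_mul tpermV eq_sym.
transitivity #|[:: 1; a; b; a * b]|.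
  by apply: eq_card => s; rewrite !inE -!orbA.
(* The sign separates [1] and [a * b] from [a] and [b]. *)
apply/card_uniqP; rewrite /= !inE !negb_or ab ab1.
by rewrite !neq_odd ?odd_permM ?odd_pairflip ?odd_perm1.
Qed.

(** * From permutation isomorphism to an equivariant group isomorphism *)

Lemma perm_morphism_conj (aT : finGroupType) (G : {group aT}) (X Y : finType)
    (f : X -> Y) (m : {morphism G >-> {perm X}}) : bijective f ->
  exists h : {morphism G >-> {perm Y}}, forall g x, h g (f x) = f (m g x).
Proof.
case=> f' fK f'K.
have inj_c (s : {perm X}) : injective (fun y => f (s (f' y))).
  by move=> y z /(can_inj fK) /perm_inj /(can_inj f'K).
have hM : {in G &, {morph (fun g => perm (inj_c (m g))) : x y / x * y}}.
  by move=> x y Gx Gy; apply/permP=> z; rewrite permM !permE fK morphM // permM.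
by exists (Morphism hM) => g x; rewrite /= permE fK.
Qed.

(** Equivariance of [f] makes point stabilisers correspond, so subgroups of the abstract group can
    be studied inside [P]. *)
Lemma perm_isomorphic_morphism (aT : finGroupType) (G : {group aT})
    (X Y : finType) (m : {morphism G >-> {perm X}}) (P : {group {perm Y}}) :
    'injm m -> perm_isomorphic (m @* G) P ->
  exists f : X -> Y, exists h : {morphism G >-> {perm Y}},
    [/\ injective f, 'injm h, h @* G = P & forall g x, h g (f x) = f (m g x)].
Proof.
move=> inj_m [f bij_f mP]; have [h hE] := perm_morphism_conj m bij_f.
exists f, h; split=> //; first exact: bij_inj.
  apply/subsetP=> g /[dup]/dom_ker Gg /mker hg1; apply: (subsetP inj_m).
  apply/kerP=> //; apply/permP=> x; apply: (bij_inj bij_f).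
  by rewrite -hE hg1 !perm1.
case: bij_f => f' fK f'K.
apply/setP=> t; apply/morphimP/idP=> [[g Gg _ ->] | Pt].
  by rewrite -(mP (m g)) ?mem_morphim // => x; rewrite hE.
have inj_s : injective (fun x => f' (t (f x))).
  by move=> x y /(can_inj f'K) /perm_inj /(can_inj fK).
have: perm inj_s \in m @* G by rewrite (mP _ t) // => x; rewrite permE f'K.
case/morphimP=> g Gg _ sE; exists g => //.
by apply/permP=> y; rewrite -(f'K y) hE -sE permE f'K.
Qed.

(** * Intermediate fields through the Galois correspondence *)

Theorem proposition4p5 (k : fieldType) (L : splittingFieldType k)
    (K Kt : {subfield L})
    (sepK : separable 1%VS K) (degK : \dim K = 6)
    (closKt : is_galois_closure K Kt)
    (galKt : perm_isomorphic (gal_translations K Kt) group_2A4) :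
  exists F1 F2 : {subfield L},
    F1 <> F2 /\
    forall F : {subfield L},
      [/\ (K <= F)%VS, (F <= Kt)%VS, \dim F = 12
        & almost_classically_galois F] <-> F = F1 \/ F = F2.
Proof.
rewrite -gal_translation_im in galKt.
have [f [h [inj_f inj_h imh hE]]] :=
  perm_isomorphic_morphism (gal_translation_inj closKt) galKt.
have [sKKt galK1 minKt] := closKt.
(* The base coset has stabiliser ['Gal(Kt / K)], which therefore matches the stabiliser [S] of
   [p]. *)
pose p := f (base_coset K Kt).
pose a := pairflip (p + 1%R)%R; pose b := pairflip (p + 2%R)%R.
set S := [set 1; a; b; a * b].
have defH g : g \in 'Gal(Kt / 1%VS) -> (g \in 'Gal(Kt / K)) = (h g \in S).
  move=> Gg; rewrite -gal_translation_base // -(inj_eq inj_f) -hE.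
  by rewrite -stab_2A4 -imh mem_morphim.
have imH : h @* 'Gal(Kt / K) = S.
  apply/setP=> s; apply/morphimP/idP=> [[g Gg Hg ->] | Ss].
    by rewrite -defH.
  have: s \in group_2A4 by move: Ss; rewrite -stab_2A4 => /andP[].
  by rewrite -imh => /morphimP[g Gg _ defs]; exists g; rewrite ?defH -?defs.
have cG : #|'Gal(Kt / 1%VS)| = 24.
  rewrite -(Lagrange (gal_sub1 K Kt)) -gal_closure_dim // degK.
  by rewrite -(card_injm inj_h (gal_sub1 K Kt)) imH card_stab_2A4.
have cE : #|even_2A4| = 12.
  have := Lagrange (subsetIl group_2A4 'Alt_('Z_6)); rewrite index_even_2A4.
  rewrite -imh card_injm // cG => e; apply/eqP.
  by rewrite -(eqn_pmul2r (isT : 0 < 2)); apply/eqP.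
(* A Galois extension of the base field containing [F] also contains [K], hence [Kt]. *)
have mid (F : {subfield L}) : (K <= F)%VS -> (F <= Kt)%VS -> is_galois_closure F Kt.
  move=> sKF sFKt; split=> // M' sFM'; apply: minKt; exact: subv_trans sFM'.
have fixGal (F : {subfield L}) : (F <= Kt)%VS -> fixedField 'Gal(Kt / F) = F.
  by move=> sFKt; apply/galois_fixedField/(galoisS _ galK1); rewrite sub1v.
have sFG (F : {subfield L}) := gal_sub1 F Kt.
(* A normal complement to a subgroup of order 2 has index 2, so [h] maps it onto [even_2A4].
   Conversely the preimage of [even_2A4] is normal, being of index 2, and complements as soon as the
   intersection is trivial, since 2 * 12 = 24. *)
have acgE (F : {subfield L}) : (K <= F)%VS -> (F <= Kt)%VS -> #|'Gal(Kt / F)| = 2 ->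
    almost_classically_galois F <-> h @* 'Gal(Kt / F) :&: even_2A4 = 1.
  move=> sKF sFKt cQ.
  apply: (iff_trans (almost_classically_galoisP (mid F sKF sFKt))).
  split=> [[D /andP[sDG nDG] /complP[tiQD defG]] | tiQ].
    have iD : #|'Gal(Kt / 1%VS) : D| = 2.
      have := TI_cardMg tiQD; rewrite defG cG cQ => cD.
      by rewrite -divgS // cG cD mulnK.
    have <- : h @* D = even_2A4.
      by apply: index2_2A4; rewrite -imh ?morphimS ?index_injm.
    by rewrite -injmI // tiQD morphim1.
  pose D := (h @*^-1 even_2A4)%G.
  have hD : h @* D = even_2A4 by rewrite morphpreK // imh subsetIl.
  have sDG : D \subset 'Gal(Kt / 1%VS) by apply: subsetIl.
  have cD : #|D| = 12 by rewrite -(card_injm inj_h sDG) hD.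
  have tiQD : 'Gal(Kt / F) :&: D = 1.
    by apply/eqP; rewrite -(morphim_injm_eq1 inj_h) ?subIset ?sFG // injmI // hD tiQ.
  exists D; first by apply: index2_normal => //; rewrite -divgS // cG cD.
  apply/complP; split=> //; apply/eqP; rewrite eqEcard mul_subG //=.
  by rewrite TI_cardMg // cQ cD cG.
(* The two required fields are [Fx a] and [Fx b]. *)
pose Fx x : {subfield L} := fixedField_aspace (h @*^-1 <[x]>).
have Fx_eq (F : {subfield L}) x : x \in S ->
    F = Fx x <-> (F <= Kt)%VS /\ h @* 'Gal(Kt / F) = <[x]>.
  move=> Sx; have Px : <[x]> \subset h @* 'Gal(Kt / 1%VS).
    by rewrite imh cycle_subG; move: Sx; rewrite -stab_2A4 => /andP[].
  split=> [-> | [sFKt hF]].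
    by rewrite gal_fixedField morphpreK // fixedField_bound.
  apply: val_inj => /=; rewrite -hF injmK //.
  exact/esym/fixGal.
have [Sa Sb] : a \in S /\ b \in S by rewrite !inE !eqxx !orbT.
exists (Fx a), (Fx b); split.
  (* Equal fields would give [<[a]> = <[b]>], forcing [b] to be [1] or [a]. *)
  move=> eqF; have [_ hFa] := (Fx_eq (Fx a) a Sa).1 erefl.
  have [_] := (Fx_eq (Fx a) b Sb).1 eqF; rewrite hFa => eq_ab.
  have: b \in <[a]> by rewrite eq_ab cycle_id.
  rewrite cycle2g ?order_pairflip // !inE => /pred2P[b1 | ba].
    by have := odd_pairflip (p + 2%R)%R; rewrite -/b b1 odd_perm1.
  by case/eqP: (pairflip_neq p); rewrite -/a -/b ba.
move=> F; split.
  case=> sKF sFKt dimF acgF.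
  have cQ : #|'Gal(Kt / F)| = 2.
    have := Lagrange (sFG F); rewrite cG -gal_closure_dim ?dimF //; last exact: mid.
    by rewrite -[24]/(2 * 12)%N => /eqP; rewrite eqn_pmul2r // => /eqP.
  have sQS : h @* 'Gal(Kt / F) \subset S by rewrite -imH morphimS ?galS.
  have chQ : #|h @* 'Gal(Kt / F)| = 2 by rewrite card_injm.
  have /acgE/(order2_stab_2A4 sQS chQ) := acgF.
  by case=> // hF; [left | right]; apply/Fx_eq.
move=> defF.
have [sFKt hF] : (F <= Kt)%VS /\
    (h @* 'Gal(Kt / F) = <[a]> \/ h @* 'Gal(Kt / F) = <[b]>).
  by case: defF => /Fx_eq[] // sFKt hF; split=> //; [left | right].
have cQ : #|'Gal(Kt / F)| = 2.
  by rewrite -(card_injm inj_h) //; case: hF => ->; rewrite -orderE order_pairflip.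
(* [K <= F] is recovered by reversing inclusions: [<[a]>] and [<[b]>] lie in the image of
   ['Gal(Kt / K)]. *)
have sQH : 'Gal(Kt / F) \subset 'Gal(Kt / K).
  by rewrite -(injmSK inj_h) // imH; case: hF => ->; rewrite -imH cycle_subG /= imH.
have sKF : (K <= F)%VS by rewrite -(fixGal K) // -(fixGal F) // fixedFieldS.
split=> //; last first.
  have sQS : h @* 'Gal(Kt / F) \subset S by rewrite -imH morphimS.
  have chQ : #|h @* 'Gal(Kt / F)| = 2 by rewrite card_injm.
  exact/acgE/(order2_stab_2A4 sQS chQ).
by rewrite (gal_closure_dim (mid F sKF sFKt)) -divgS //= cG cQ.
Qed.
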